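(* Every scalable frame has a scalable alternate dual frame.
   Context: All frames are finite frames in $\mathbb{R}^n$: a sequence $\{x_i\}_{i=1}^m\subset\mathbb{R}^n$ is a frame for $\mathbb{R}^n$ if there are $0<A\le B<\infty$ with $A\|x\|^2\le\sum_{i=1}^m|\langle x,x_i\rangle|^2\le B\|x\|^2$ for all $x\in\mathbb{R}^n$; it is tight if one can take $A=B$. A frame $\{x_i\}_{i=1}^m$ is scalable if there exist non-negative constants $a_1,\dots,a_m$ such that $\{a_ix_i\}_{i=1}^m$ is a tight frame. The frame operator of $\{x_i\}_{i=1}^m$ is the invertible operator $S$ on $\mathbb{R}^n$ given by $Sx=\sum_{i=1}^m\langle x,x_i\rangle x_i$. A sequence $\{y_i\}_{i=1}^m\subset\mathbb{R}^n$ is a dual frame for $\{x_i\}_{i=1}^m$ if $x=\sum_{i=1}^m\langle x,x_i\rangle y_i=\sum_{i=1}^m\langle x,y_i\rangle x_i$ for all $x\in\mathbb{R}^n$. If $y_i=S^{-1}x_i$ for all $i=1,\dots,m$, then $\{y_i\}_{i=1}^m$ is called the canonical dual frame; otherwise it is called an alternate dual frame.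
   Formalization: The claim fails for a frame that is a basis (m = n, e.g. an orthonormal basis), whose only dual is canonical, and for n = 0; so n ≥ 1 is assumed and the scalable dual is asserted to be alternate only when m > n. *)

(* Defs.v *)
From HB Require Import structures.
From mathcomp Require Import all_boot all_order all_algebra.
From mathcomp Require Import reals.

Set Implicit Arguments.
Unset Strict Implicit.
Unset Printing Implicit Defensive.

Import Order.TTheory GRing.Theory Num.Theory.
Local Open Scope ring_scope.

Section Frames.
Variables (R : realType) (m n : nat).

(* The norm that MathComp-Analysis puts on 'rV[R]_n is the max norm, hence the
   explicit Euclidean structure. *)
Definition dot (u v : 'rV[R]_n) : R := \sum_(k < n) u 0 k * v 0 k.

Definition l2norm (v : 'rV[R]_n) : R := Num.sqrt (dot v v).

Implicit Types x y : 'I_m -> 'rV[R]_n.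

Definition frame_bounds x (A B : R) : Prop :=
  forall v : 'rV[R]_n,
    A * l2norm v ^+ 2 <= \sum_(i < m) `|dot v (x i)| ^+ 2 <= B * l2norm v ^+ 2.

Definition is_frame x : Prop :=
  exists A B : R, 0 < A <= B /\ frame_bounds x A B.

Definition is_tight_frame x : Prop :=
  exists A : R, 0 < A /\ frame_bounds x A A.

Definition is_scalable_frame x : Prop :=
  is_frame x /\
  exists a : 'I_m -> R,
    (forall i, 0 <= a i) /\ is_tight_frame (fun i => a i *: x i).

Definition frame_op x (v : 'rV[R]_n) : 'rV[R]_n :=
  \sum_(i < m) dot v (x i) *: x i.

Definition is_dual_frame x y : Prop :=
  forall v : 'rV[R]_n,
    v = \sum_(i < m) dot v (x i) *: y i /\
    v = \sum_(i < m) dot v (y i) *: x i.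

(* Matrices act on row vectors from the right: see mul_frame_mx and
   frame_mx_unit. *)
Definition frame_mx x : 'M[R]_n := lin1_mx (frame_op x).

Definition inv_frame_op x (v : 'rV[R]_n) : 'rV[R]_n := v *m invmx (frame_mx x).

Definition is_canonical_dual x y : Prop :=
  is_dual_frame x y /\ forall i, y i = inv_frame_op x (x i).

Definition is_alternate_dual x y : Prop :=
  is_dual_frame x y /\ ~ is_canonical_dual x y.

Lemma dotE u v : dot u v = (u *m v^T) 0 0.
Proof. by rewrite mxE; apply: eq_bigr => k _; rewrite mxE. Qed.

Let family_mx x : 'M[R]_(m, n) := \matrix_i x i.

Let synthE x y v :
  \sum_(i < m) dot v (x i) *: y i = v *m ((family_mx x)^T *m family_mx y).
Proof.
rewrite mulmxA mulmx_sum_row; apply: eq_bigr => i _; rewrite rowK; congr (_ *: _).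
by rewrite mxE; apply: eq_bigr => k _; rewrite !mxE.
Qed.

Let frame_mxE x : frame_mx x = (family_mx x)^T *m family_mx x.
Proof.
apply/row_matrixP => i; rewrite rowE [in RHS]rowE -synthE.
by apply/rowP => j; rewrite -rowE !mxE.
Qed.

Lemma mul_frame_mx x v : v *m frame_mx x = frame_op x v.
Proof. by rewrite frame_mxE -synthE. Qed.

Lemma frame_mx_unit x : is_frame x -> frame_mx x \in unitmx.
Proof.
move=> [A [B [/andP[A0 _] hAB]]].
rewrite -row_free_unit -kermx_eq0; apply/eqP/row_matrixP => i; rewrite row0.
set v := row i _.
have Sv : frame_op x v = 0.
  by rewrite -mul_frame_mx; apply/eqP; rewrite -sub_kermx row_sub.
have v20 : 0 <= dot v v by apply: sumr_ge0 => k _; rewrite -expr2 sqr_ge0.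
have : dot v v <= 0.
  have /andP[+ _] := hAB v; rewrite /l2norm sqr_sqrtr//.
  suff -> : \sum_(j < m) `|dot v (x j)| ^+ 2 = 0 by rewrite pmulr_rle0.
  transitivity (dot (frame_op x v) v); last first.
    by rewrite Sv dotE mul0mx mxE.
  rewrite dotE mulmx_suml summxE; apply: eq_bigr => j _.
  rewrite -scalemxAl mxE -dotE real_normK ?num_real// expr2; congr (_ * _).
  by rewrite /dot; apply: eq_bigr => k _; rewrite mulrC.
move=> vle; have /eqP : dot v v = 0 by apply/eqP; rewrite eq_le vle v20.
rewrite psumr_eq0; last by move=> k _; rewrite -expr2 sqr_ge0.
move=> /allP h; apply/rowP => k; have := h k (mem_index_enum _).
by rewrite /= -expr2 sqrf_eq0 [in RHS]mxE => /eqP.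
Qed.

(* A basis (m = n) has no dual but the canonical one. *)
Lemma alternate_dual_lt x y :
  is_frame x -> is_alternate_dual x y -> (n < m)%N.
Proof.
move=> fx [dxy ncan]; rewrite ltnNge; apply/negP => mn; apply: ncan; split => //.
have XY1 : (family_mx x)^T *m family_mx y = 1%:M.
  apply/row_matrixP => i; rewrite !rowE -synthE mulmx1.
  by have [<- _] := dxy (delta_mx 0 i).
have nm : (n <= m)%N.
  rewrite -[n](mxrank1 R) -XY1.
  exact: leq_trans (mxrankM_maxr _ _) (rank_leq_row _).
have Su := frame_mx_unit fx.
have YX : family_mx y *m (family_mx x)^T = 1%:M.
  have emn : m = n by apply/eqP; rewrite eqn_leq mn nm.
  move: (family_mx x) (family_mx y) XY1; rewrite emn => X Y.
  exact: mulmx1C.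
move=> i; rewrite /inv_frame_op.
have yS : y i *m frame_mx x = x i.
  rewrite frame_mxE mulmxA -[y i](rowK y) -row_mul YX -row_mul mul1mx.
  by rewrite rowK.
by rewrite -{1}yS mulmxK.
Qed.

End Frames.

(* Main.v *)
(* Normalize the scaling so that sum_i d_i x_i x_i^T = 1, with d_i >= 0.
   Then y_i = d_i x_i is a dual frame, made tight by the weights 1 / d_i.
   Suppose it is the canonical dual and m > n.
   If some d_k = 0, then x_k = 0, so y_k may be replaced by any nonzero vector,
   with weight 0.  Otherwise take a relation sum_i w_i x_i = 0 with w <> 0,
   an index k with x_k <> 0, and put y_i = d_i x_i + s w_i x_k.  The cross terms
   of sum_i <u, y_i>^2 / d_i vanish because of the relation, leaving
   |u|^2 + s^2 C <u, x_k>^2 with C = sum_i w_i^2 / d_i; since y_k is still a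
   multiple of x_k, the excess is absorbed by lowering the weight of y_k. *)
Require Import Defs.
From mathcomp Require Import all_boot all_order all_algebra.
From mathcomp Require Import reals.
From mathcomp Require Import ring.

Section ScalableDuals.
Local Set Implicit Arguments.
Local Unset Strict Implicit.
Import Order.TTheory GRing.Theory Num.Theory.
Local Open Scope ring_scope.
Variables (R : realType) (m n : nat).
Implicit Types (u v : 'rV[R]_n) (x y : 'I_m -> 'rV[R]_n) (d e w : 'I_m -> R).

Lemma dotC u v : dot u v = dot v u.
Proof. by apply: eq_bigr => k _; rewrite mulrC. Qed.

Lemma dotDr u v v' : dot u (v + v') = dot u v + dot u v'.
Proof. by rewrite -big_split; apply: eq_bigr => k _; rewrite mxE mulrDr. Qed.

Lemma dotZr c u v : dot u (c *: v) = c * dot u v.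
Proof. by rewrite mulr_sumr; apply: eq_bigr => k _; rewrite mxE mulrCA. Qed.

Lemma dot0r u : dot u 0 = 0.
Proof. by rewrite /dot big1 // => k _; rewrite mxE mulr0. Qed.

Lemma dot_sumr u x : dot u (\sum_i x i) = \sum_i dot u (x i).
Proof. exact: (big_morph _ (dotDr u) (dot0r u)). Qed.

Lemma dot_delta u k : dot u (delta_mx 0 k) = u 0 k.
Proof.
rewrite /dot (bigD1 k) //= mxE !eqxx mulr1 big1 ?addr0 // => j /negPf jk.
by rewrite mxE eqxx jk mulr0.
Qed.

Lemma dot_ge0 u : 0 <= dot u u.
Proof. by apply: sumr_ge0 => k _; rewrite -expr2 sqr_ge0. Qed.

Lemma l2normE u : l2norm u ^+ 2 = dot u u.
Proof. by rewrite sqr_sqrtr ?dot_ge0. Qed.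

(** A crude stand-in for Cauchy-Schwarz: each [|u 0 k|] is at most [l2norm u]. It only serves to get
    some finite upper frame bound. *)
Lemma dot_le_l2norm u v : `|dot u v| <= l2norm u * \sum_k `|v 0 k|.
Proof.
rewrite (le_trans (ler_norm_sum _ _ _)) // mulr_sumr ler_sum // => k _.
rewrite normrM ler_wpM2r // -sqrtr_sqr ler_sqrt ?dot_ge0 //.
rewrite /dot (bigD1 k) //= -expr2 lerDl.
by apply: sumr_ge0 => j _; rewrite -expr2 sqr_ge0.
Qed.

Lemma tight_quadratic_form y :
  is_tight_frame y <->
  exists A : R, 0 < A /\ forall u, \sum_i dot u (y i) ^+ 2 = A * dot u u.
Proof.
split=> -[A [A0 hA]]; exists A; split=> // u.
  have := hA u; rewrite l2normE => /le_anti ->; apply: eq_bigr => i _.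
  by rewrite real_normK ?num_real.
under eq_bigr => i _ do rewrite real_normK ?num_real //.
by rewrite l2normE hA lexx.
Qed.

(** The scaling constants are the square roots of the [e i]. The lower frame bound comes from the
    same identity, since every [e i] is at most [M]. *)
Lemma scalable_of_weights y e :
  (forall i, 0 <= e i) ->
  (forall u, \sum_i e i * dot u (y i) ^+ 2 = dot u u) ->
  is_scalable_frame y.
Proof.
move=> e0 he; split; last first.
  exists (fun i => Num.sqrt (e i)); split; first by move=> i; exact: sqrtr_ge0.
  apply/tight_quadratic_form; exists 1; split=> // u; rewrite mul1r -he.
  by apply: eq_bigr => i _; rewrite dotZr exprMn sqr_sqrtr.
pose M := 1 + \sum_i e i.
have M0 : 0 < M by rewrite ltr_pwDl // sumr_ge0.
have eM i : e i <= M.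
  by rewrite /M (bigD1 i) //= addrCA lerDl addr_ge0 // sumr_ge0.
(* The term [M^-1] is there only to make the upper bound at least the lower one. *)
pose B := M^-1 + \sum_i (\sum_k `|y i 0 k|) ^+ 2.
have B0 : M^-1 <= B by rewrite lerDl sumr_ge0 // => i _; exact: sqr_ge0.
exists M^-1, B; split; first by rewrite invr_gt0 M0.
move=> u; apply/andP; split.
  rewrite l2normE ler_pdivrMl // -he mulr_sumr ler_sum // => i _.
  by rewrite real_normK ?num_real // ler_wpM2r ?sqr_ge0.
rewrite mulrDl -[leLHS]add0r lerD //.
  by rewrite mulr_ge0 ?sqr_ge0 // invr_ge0 ltW.
rewrite mulr_suml ler_sum // => i _; rewrite -exprMn mulrC.
rewrite ler_sqr ?nnegrE ?dot_le_l2norm // mulr_ge0 ?sqrtr_ge0 //.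
by rewrite sumr_ge0.
Qed.

Lemma scalable_weights x :
  is_scalable_frame x ->
  exists d, (forall i, 0 <= d i) /\
    forall u v, \sum_i d i * (dot u (x i) * dot v (x i)) = dot u v.
Proof.
move=> [_ [a [a0 /tight_quadratic_form [A [A0 hA]]]]].
exists (fun i => a i ^+ 2 / A); split.
  by move=> i; rewrite divr_ge0 ?sqr_ge0 // ltW.
have q u : \sum_i a i ^+ 2 / A * dot u (x i) ^+ 2 = dot u u.
  apply: (mulfI (lt0r_neq0 A0)); rewrite -hA mulr_sumr; apply: eq_bigr => i _.
  by rewrite dotZr; field; exact: lt0r_neq0.
move=> u v; apply: (@mulfI _ 2%:R); first by rewrite pnatr_eq0.
(* Polarization turns the quadratic identity [q] into the bilinear one. *)
have -> : 2%:R * dot u v = dot (u + v) (u + v) - dot u u - dot v v.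
  by rewrite dotDr ![dot (u + v) _]dotC !dotDr [dot v u]dotC; ring.
rewrite -!q -!sumrB mulr_sumr; apply: eq_bigr => i _.
by rewrite ![dot _ (x i)]dotC dotDr; ring.
Qed.

Section NormalizedWeights.
Variables (x : 'I_m -> 'rV[R]_n) (d : 'I_m -> R).
Hypothesis d_ge0 : forall i, 0 <= d i.
Hypothesis dP :
  forall u v, \sum_i d i * (dot u (x i) * dot v (x i)) = dot u v.

(** The added terms contribute [dot u (\sum_i w i *: x i) *: v] to one reconstruction formula and
    [dot u v *: \sum_i w i *: x i] to the other; the relation kills both. *)
Lemma dual_perturbation w v :
  \sum_i w i *: x i = 0 -> is_dual_frame x (fun i => d i *: x i + w i *: v).
Proof.
move=> wx u; have du : u = \sum_i dot u (x i) *: (d i *: x i).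
  apply/rowP => k; rewrite -dot_delta -dP summxE; apply: eq_bigr => i _.
  by rewrite !mxE [dot (delta_mx _ _) _]dotC dot_delta; ring.
split.
  under eq_bigr do rewrite scalerDr; rewrite big_split /= -du.
  have -> : \sum_i dot u (x i) *: (w i *: v) = dot u (\sum_i w i *: x i) *: v.
    rewrite dot_sumr scaler_suml; apply: eq_bigr => i _.
    by rewrite dotZr scalerA mulrC.
  by rewrite wx dot0r scale0r addr0.
under eq_bigr do rewrite dotDr !dotZr scalerDl; rewrite big_split /=.
have -> : \sum_i (w i * dot u v) *: x i = dot u v *: \sum_i w i *: x i.
  by rewrite scaler_sumr; apply: eq_bigr => i _; rewrite scalerA mulrC.
rewrite wx scaler0 addr0 [LHS]du; apply: eq_bigr => i _.
by rewrite scalerA mulrC.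
Qed.

Lemma dual_scaled : is_dual_frame x (fun i => d i *: x i).
Proof.
have := @dual_perturbation (fun=> 0) 0; rewrite big1 => [/(_ erefl) h u|i _].
  have [e1 e2] := h u; split; [rewrite {1}e1 | rewrite {1}e2];
  by apply: eq_bigr => i _; rewrite scaler0 addr0.
by rewrite scale0r.
Qed.

(* Also correct where [d i = 0], as the inverse of [0] is [0]. *)
Lemma sum_inv_weights u : \sum_i (d i)^-1 * dot u (d i *: x i) ^+ 2 = dot u u.
Proof.
rewrite -dP; apply: eq_bigr => i _; rewrite dotZr.
have [->|di] := eqVneq (d i) 0; first by rewrite invr0 !mul0r.
by field.
Qed.

Lemma scalable_scaled_dual : is_scalable_frame (fun i => d i *: x i).
Proof.
apply: (@scalable_of_weights _ (fun i => (d i)^-1)) sum_inv_weights => i.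
by rewrite invr_ge0.
Qed.

(** The vector at [k] has weight [0^-1 = 0], so changing it leaves the weighted sum unchanged. *)
Lemma scalable_replace_zero k v : d k = 0 ->
  is_scalable_frame (fun i => d i *: x i + (i == k)%:R *: v).
Proof.
move=> dk; apply: (@scalable_of_weights _ (fun i => (d i)^-1)).
  by move=> i; rewrite invr_ge0.
move=> u; rewrite -sum_inv_weights; apply: eq_bigr => i _.
have [->|] := eqVneq i k; first by rewrite dk invr0 !mul0r.
by rewrite scale0r addr0.
Qed.

Lemma scalable_perturbation w k :
  (forall i, 0 < d i) -> \sum_i w i *: x i = 0 -> 0 <= w k ->
  (exists i, w i != 0) ->
  exists s, 0 < s /\
    is_scalable_frame (fun i => d i *: x i + w i *: (s *: x k)).
Proof.
move=> d0 wx wk [j wj].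
pose C := \sum_i w i ^+ 2 / d i.
have C0 : 0 < C.
  rewrite /C (bigD1 j) //= ltr_pwDl //.
    by rewrite divr_gt0 // exprn_even_gt0.
  by apply: sumr_ge0 => i _; rewrite divr_ge0 ?sqr_ge0.
(* With this [s] the excess [s ^+ 2 * C * dot u (x k) ^+ 2] has coefficient exactly [d k]. *)
pose s := Num.sqrt (d k / C).
have s0 : 0 < s by rewrite sqrtr_gt0 divr_gt0.
have s2 : s ^+ 2 * C = d k.
  by rewrite sqr_sqrtr ?divfK ?gt_eqF // ltW // divr_gt0.
exists s; split=> //.
(* The perturbed vector at [k] is [t *: x k]. As [w k] is nonnegative, [d k <= t], which keeps the
   lowered weight [(d k)^-1 - d k / t ^+ 2] nonnegative. *)
pose t := d k + s * w k.
have t0 : 0 < t by rewrite ltr_wpDr // mulr_ge0 // ltW.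
apply: (@scalable_of_weights _
  (fun i => (d i)^-1 - (i == k)%:R * (d k / t ^+ 2))).
  move=> i; have [->|_] := eqVneq i k; last by rewrite mul0r subr0 invr_ge0.
  rewrite mul1r subr_ge0 ler_pdivrMr ?exprn_gt0 // mulrC ler_pdivlMr //.
  by rewrite -expr2 ler_sqr ?nnegrE ?(ltW t0) ?(ltW (d0 k)) // lerDl mulr_ge0 // ltW.
move=> u; under eq_bigr do rewrite mulrBl; rewrite sumrB.
rewrite [X in _ - X](bigD1 k) //= [X in _ - (_ + X)]big1; last first.
  by move=> i /negPf ->; rewrite !mul0r.
rewrite eqxx scalerA -scalerDl [w k * s]mulrC -/t dotZr addr0 mul1r.
have -> : d k / t ^+ 2 * (t * dot u (x k)) ^+ 2 = d k * dot u (x k) ^+ 2.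
  by field; exact: lt0r_neq0.
apply/eqP; rewrite subr_eq; apply/eqP.
have cross : \sum_i w i * dot u (x i) = 0.
  rewrite -[RHS](dot0r u) -wx dot_sumr.
  by apply: eq_bigr => i _; rewrite dotZr.
rewrite -s2 -(sum_inv_weights u) -[in LHS](addr0 (\sum_i _)).
transitivity (\sum_i (d i)^-1 * dot u (d i *: x i) ^+ 2
  + 2%:R * s * dot u (x k) * \sum_i w i * dot u (x i)
  + s ^+ 2 * C * dot u (x k) ^+ 2); last by rewrite cross mulr0 !addr0.
rewrite addr0 mulr_sumr [s ^+ 2 * C]mulr_sumr mulr_suml -!big_split /=.
by apply: eq_bigr => i _; rewrite dotDr !dotZr; field; exact: lt0r_neq0.
Qed.

Lemma exists_neq0 : (0 < n)%N -> exists k, x k != 0.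
Proof.
move=> n0; apply/existsP; apply: contraT; rewrite negb_exists => /forallP x0.
pose u : 'rV[R]_n := delta_mx 0 (Ordinal n0).
have := dP u u; rewrite big1; last first.
  by move=> i _; have := x0 i; rewrite negbK => /eqP ->; rewrite dot0r !mulr0.
by move=> /eqP; rewrite dot_delta mxE !eqxx eq_sym oner_eq0.
Qed.

End NormalizedWeights.

(** More vectors than the dimension are dependent; a relation with the wrong sign at [k] is
    negated. *)
Lemma exists_relation x k : (n < m)%N ->
  exists w, [/\ \sum_i w i *: x i = 0, 0 <= w k & exists i, w i != 0].
Proof.
move=> nm; pose X : 'M[R]_(m, n) := \matrix_i x i.
have /rowV0Pn[z zX z0] : kermx X != 0.
  rewrite kermx_eq0 /row_free; apply: contraTneq nm => <-.
  by rewrite -leqNgt rank_leq_col.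
have relz : \sum_i z 0 i *: x i = 0.
  move: zX; rewrite sub_kermx mulmx_sum_row => /eqP zX; rewrite -[RHS]zX.
  by apply: eq_bigr => i _; rewrite rowK.
have [i zi] : exists i, z 0 i != 0 by move/rV0Pn: z0.
have [zk|zk] := leP 0 (z 0 k); first by exists (z 0); split=> //; exists i.
exists (fun i => - z 0 i); split; first 2 last.
- by exists i; rewrite oppr_eq0.
- by under eq_bigr do rewrite scaleNr; rewrite sumrN relz oppr0.
- by rewrite oppr_ge0 ltW.
Qed.

Lemma alternate_perturbation x y w v :
  (forall i, y i = inv_frame_op x (x i)) ->
  (exists i, w i != 0) -> v != 0 ->
  is_dual_frame x (fun i => y i + w i *: v) ->
  is_alternate_dual x (fun i => y i + w i *: v).
Proof.
move=> yc [i wi] v0 dy; split=> // -[_ /(_ i)].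
rewrite -yc => /eqP; rewrite -subr_eq0 addrAC subrr add0r scaler_eq0.
by rewrite (negPf wi) (negPf v0).
Qed.

Lemma scalable_alternate_dual x d :
  (0 < n)%N -> (n < m)%N -> (forall i, 0 <= d i) ->
  (forall u v, \sum_i d i * (dot u (x i) * dot v (x i)) = dot u v) ->
  (forall i, d i *: x i = inv_frame_op x (x i)) ->
  is_frame x ->
  exists y, is_scalable_frame y /\ is_alternate_dual x y.
Proof.
move=> n0 nm d0 dP can fx; have [k xk] := exists_neq0 dP n0.
have [/existsP[l /eqP dl]|] := boolP [exists i, d i == 0].
  (* Here the canonical dual vector at [l] is 0, and the frame operator is injective. So the
     indicator of [l] is itself a relation. *)
  have xl : x l = 0.
    have := can l; rewrite dl scale0r => /esym xS0.
    by rewrite -[x l](mulmxKV (frame_mx_unit fx)) -/(inv_frame_op _ _) xS0 mul0mx.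
  exists (fun i => d i *: x i + (i == l)%:R *: x k).
  split; first exact: scalable_replace_zero.
  apply: alternate_perturbation => //; first by exists l; rewrite eqxx oner_eq0.
  apply: dual_perturbation => //; apply: big1 => i _.
  by have [->|_] := eqVneq i l; rewrite ?xl ?scaler0 ?scale0r.
rewrite negb_exists => /forallP dn0.
have dpos i : 0 < d i by rewrite lt0r dn0 d0.
have [w [wx wk wn0]] := exists_relation x k nm.
have [s [s0 sc]] := scalable_perturbation d0 dP dpos wx wk wn0.
exists (fun i => d i *: x i + w i *: (s *: x k)); split=> //.
apply: alternate_perturbation => //; last exact: dual_perturbation.
by rewrite scaler_eq0 negb_or gt_eqF.
Qed.

End ScalableDuals.

Theorem theorem5p1 (R : realType) (m n : nat) (hn : (0 < n)%N)
  (x : 'I_m -> 'rV[R]_n) (hx : is_scalable_frame x) :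
  exists y : 'I_m -> 'rV[R]_n,
    is_dual_frame x y /\ is_scalable_frame y /\
    ((n < m)%N -> is_alternate_dual x y).
Proof.
have [d [d0 dP]] := scalable_weights hx.
have dy := dual_scaled dP; have sy := scalable_scaled_dual d0 dP.
set y := (fun i => _) in dy sy.
have [nm|mn] := ltnP n m; last by exists y.
(* The dual [y] already serves unless it is the canonical one. *)
have [/forallP can|ncan] := boolP [forall i, y i == inv_frame_op x (x i)].
  have [z [sz az]] := scalable_alternate_dual hn nm d0 dP
    (fun i => eqP (can i)) (proj1 hx).
  by exists z; split; [case: az|].
exists y; split=> //; split=> // _; split=> // -[_ can].
by case/negP: ncan; apply/forallP => i; apply/eqP.
Qed.
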